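(* Fix integers $n,k\ge 1$ and let $$R(w)=w^k+\sum_{\ell=0}^{k-1}r_\ell w^\ell\in\mathbb C[w]$$ be a monic polynomial of degree $k$. For every degree-$n$ polynomial $P\in\mathbb C[w]$, the equation $$\frac{\mathrm d^k}{\mathrm dw^k}\bigl(R(w)Q(w)\bigr)=(n+1)_k\,P(w)$$ has a unique degree-$n$ solution $Q$. There is a degree-$n$ polynomial $S$, independent of $P$, such that $$Q=P\star_{\mathrm G}S$$ for every such $P$ (with $Q$ the corresponding solution) if and only if $$r_\ell=0\quad\text{for all integers }\ell\text{ with }\max\{0,k-n\}\le\ell\le k-1.\qquad( * )$$ When $( * )$ holds, one may take $S(w)=S_{n,k}(w)=\sum_{j=0}^n\binom{n+k}{j+k}w^j$. The coefficients $r_\ell$ with $\ell+n<k$ are invisible to the $k$-th derivative for every $Q$ of degree at most $n$; that is, for every polynomial $Q$ of degree at most $n$, the polynomial $\frac{\mathrm d^k}{\mathrm dw^k}(R(w)Q(w))$ does not depend on the values of those $r_\ell$. In particular, if $n\ge k$, a universal factorisation (a degree-$n$ polynomial $S$, independent of $P$, with $Q=P\star_{\mathrm G}S$ for every degree-$n$ polynomial $P$) exists precisely for $R(w)=w^k$; or, before translation: for $\xi\in\mathbb C$ and a monic degree-$k$ polynomial $R(z)$, with $Q$ the degree-$n$ solution of $\frac{\mathrm d^k}{\mathrm dz^k}(R(z)Q(z))=(n+1)_kP(z)$, a degree-$n$ polynomial $S$, independent of $P$, with $Q(\xi+w)=P(\xi+w)\star_{\mathrm G}S(w)$ for every degree-$n$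 polynomial $P$, exists precisely for $R(z)=(z-\xi)^k$.
   Context: $(a)_k:=a(a+1)\cdots(a+k-1)$ denotes the rising factorial. All polynomials have complex coefficients. For degree-$n$ polynomials written in the binomial basis, $A(w)=\sum_{j=0}^n\binom nj a_jw^j$ and $B(w)=\sum_{j=0}^n\binom nj b_jw^j$, their Grace--Szegő convolution is $$(A\star_{\mathrm G}B)(w)=\sum_{j=0}^n\binom nj a_jb_jw^j.$$ In the expression $P(\xi+w)\star_{\mathrm G}S(w)$, the convolution is taken of the two factors regarded as polynomials in $w$. *)

(* Defs.v *)
From mathcomp Require Import all_boot all_order all_algebra.
From mathcomp Require Import reals complex.

Set Implicit Arguments.
Unset Strict Implicit.
Unset Printing Implicit Defensive.

Import Order.TTheory GRing.Theory Num.Theory.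

Local Open Scope ring_scope.

Section Definitions.
Variable F : numFieldType.
Implicit Types (A B P Q R S : {poly F}) (n k j : nat).

Definition rising_fact (a : F) k : F := \prod_(i < k) (a + i%:R).

Definition has_degree n P : Prop := size P = n.+1.

(* The coefficient a_j in A = \sum_(j <= n) 'C(n, j) a_j X^j. *)
Definition binom_coef n A j : F := A`_j / 'C(n, j)%:R.

(* The degree parameter n is explicit since the convolution depends on it. *)
Definition gs_conv n A B : {poly F} :=
  \poly_(j < n.+1) ('C(n, j)%:R * binom_coef n A j * binom_coef n B j).

Lemma gs_convE n (a b : nat -> F) :
  gs_conv n (\sum_(j < n.+1) ('C(n, j)%:R * a j) *: 'X^j)
            (\sum_(j < n.+1) ('C(n, j)%:R * b j) *: 'X^j) =
  \sum_(j < n.+1) ('C(n, j)%:R * a j * b j) *: 'X^j.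
Proof.
have pE (c : nat -> F) : \sum_(j < n.+1) ('C(n, j)%:R * c j) *: 'X^j =
    \poly_(j < n.+1) ('C(n, j)%:R * c j) by rewrite poly_def.
rewrite !pE /gs_conv poly_def.
apply: eq_bigr => j _; congr (_ *: _).
have nz : 'C(n, j)%:R != 0 :> F by rewrite pnatr_eq0 -lt0n bin_gt0 -ltnS.
by rewrite /binom_coef !coef_poly ltn_ord ![_ * _ / _]mulrAC divff // !mul1r.
Qed.

Definition monic_poly k (r : 'I_k -> F) : {poly F} :=
  'X^k + \sum_(l < k) r l *: 'X^l.

Definition is_solution n k R P Q : Prop :=
  has_degree n Q /\ (R * Q)^`(k) = rising_fact n.+1%:R k *: P.

(* Here Q ranges over the solutions for P; there is exactly one for R monic
   of degree k. *)
Definition universal_factor n k R S : Prop :=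
  has_degree n S /\
  forall P Q, has_degree n P -> is_solution n k R P Q -> Q = gs_conv n P S.

Definition translate (xi : F) P : {poly F} := P \Po ('X + xi%:P).

Definition universal_factor_at (xi : F) n k R S : Prop :=
  has_degree n S /\
  forall P Q, has_degree n P -> is_solution n k R P Q ->
    translate xi Q = gs_conv n (translate xi P) S.

Definition S_nk n k : {poly F} := \poly_(j < n.+1) 'C(n + k, j + k)%:R.

End Definitions.

(* Main.v *)
(* For R monic of degree k, L Q = (R Q)^(k) preserves degrees, hence is
   bijective on polynomials of bounded degree.  If R - X^k has degree < k - n,
   then L agrees with Q |-> (X^k Q)^(k) in degree <= n; this map is diagonal in
   the monomial basis, which gives S_nk.  Conversely, a universal factor makes
   Q_0 a fixed multiple s (L Q)_0 for all Q of degree exactly n, hence by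
   linearity for all Q of degree <= n.  Taking Q = 1 gives s != 0, and then
   Q = X^m with 0 < m <= min(n, k) gives (R X^m)_k = 0, i.e. R_(k-m) = 0.
   Translations commute with differentiation, which reduces the last claim to
   xi = 0. *)
Require Import Defs.
From mathcomp Require Import all_boot all_order all_algebra.
From mathcomp Require Import reals complex.

Set Implicit Arguments.
Unset Strict Implicit.
Unset Printing Implicit Defensive.

Import Order.TTheory GRing.Theory Num.Theory.

Local Open Scope ring_scope.

Section Solutions.
Variable F : numFieldType.
Implicit Types (xi : F) (D P Q R S : {poly F}) (n k m : nat).

(** * Invertibility of Q |-> (R Q)^(k) *)

Lemma rising_factE n k : rising_fact n.+1%:R k = ((n + k) ^_ k)%:R :> F.
Proof.
elim: k => [|k IHk]; first by rewrite /rising_fact big_ord0.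
rewrite /rising_fact big_ord_recr /= -/(rising_fact _ _) IHk addnS ffactSS.
by rewrite mulnC natrM -natrD.
Qed.

Lemma rising_fact_neq0 n k : rising_fact n.+1%:R k != 0 :> F.
Proof. by rewrite rising_factE pnatr_eq0 -lt0n ffact_gt0 leq_addl. Qed.

(** Since [R] is monic, [R * Q] has the leading coefficient of [Q]. The k-th derivative multiplies
    it by a falling factorial, nonzero in characteristic 0. *)
Lemma size_derivn_mul k R Q : R \is monic -> size R = k.+1 ->
  size (R * Q)^`(k) = size Q.
Proof.
move=> Rmon sR; have [->|Q0] := eqVneq Q 0.
  by rewrite mulr0 linear0.
have sRQ : size (R * Q) = (k + size Q)%N.
  by rewrite size_monicM // sR addSn.
have [s sQ] : exists s, size Q = s.+1.
  by exists (size Q).-1; rewrite -polySpred.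
apply/eqP; rewrite eqn_leq; apply/andP; split.
  apply/leq_sizeP=> j lej; rewrite coef_derivn nth_default ?mul0rn //.
  by rewrite sRQ leq_add2l.
rewrite sQ ltnNge; apply/negP => /leq_sizeP/(_ s (leqnn _))/eqP.
rewrite coef_derivn mulrn_eq0 -leqn0 leqNgt ffact_gt0 leq_addr /=.
have -> : (k + s)%N = (size (R * Q)).-1 by rewrite sRQ sQ addnS.
by rewrite -lead_coefE lead_coef_monicM // lead_coef_eq0 (negPf Q0).
Qed.

(** Triangularity: the image of a monomial of the degree of [P] has that same degree, so a multiple
    of it cancels the leading term of [P], and induction on the size finishes. *)
Lemma derivn_mul_surj k R P : R \is monic -> size R = k.+1 ->
  exists Q, (R * Q)^`(k) = P.
Proof.
move=> Rmon sR; have [m] := ubnP (size P).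
elim: m P => // m IHm P; rewrite ltnS => sP.
have [->|P0] := eqVneq P 0; first by exists 0; rewrite mulr0 linear0.
pose T := (R * 'X^((size P).-1))^`(k).
have sT : size T = size P.
  by rewrite size_derivn_mul // size_polyXn -polySpred.
have T0 : lead_coef T != 0.
  by rewrite lead_coef_eq0 -size_poly_gt0 sT size_poly_gt0.
pose c := lead_coef P / lead_coef T.
have [|Q QE] := IHm (P - c *: T).
  apply: leq_trans sP; rewrite [X in (_ < X)%N]polySpred //.
  rewrite ltnS; apply/leq_sizeP => j; rewrite leq_eqVlt => /orP[/eqP<-|ltj].
    by rewrite coefB coefZ -[in T`__]sT -!lead_coefE divfK // subrr.
  have lej : (size P <= j)%N by rewrite polySpred.
  by rewrite coefB coefZ !nth_default ?sT // mulr0 subr0.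
exists (Q + c *: 'X^((size P).-1)).
by rewrite mulrDr -scalerAr linearD linearZ /= QE subrK.
Qed.

Lemma is_solution_unique n k R P : R \is monic -> size R = k.+1 ->
  has_degree n P -> exists! Q, is_solution n k R P Q.
Proof.
move=> Rmon sR sP.
have [Q QE] := derivn_mul_surj (rising_fact n.+1%:R k *: P) Rmon sR.
exists Q; split.
  split=> //; rewrite /has_degree -(size_derivn_mul Q Rmon sR) QE.
  by rewrite size_scale ?rising_fact_neq0.
move=> Q' [_ Q'E]; apply/eqP; rewrite -subr_eq0 -size_poly_eq0.
by rewrite -(size_derivn_mul _ Rmon sR) mulrBr linearB /= QE Q'E subrr size_poly0.
Qed.

(** * Universal factors for R *)

Lemma derivn_mul_low n k D Q : (size D <= k - n)%N -> (size Q <= n.+1)%N ->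
  (D * Q)^`(k) = 0.
Proof.
have [->|D0] := eqVneq D 0; first by rewrite mul0r linear0.
move=> sD sQ; apply: derivn_poly0; apply: leq_trans (size_polyMleq _ _) _.
(* A nonzero [D] makes [k - n] positive, so this truncated subtraction is exact. *)
have ltnk : (n < k)%N.
  by rewrite -subn_gt0; apply: leq_trans sD; rewrite size_poly_gt0.
rewrite -subn1 leq_subLR add1n; apply: leq_trans (leq_add sD sQ) _.
by rewrite addnS subnK // ltnW.
Qed.

(** Both sides become (n + k)! after multiplication by j! (n - j)!. This identity produces the
    binomials in [S_nk]. *)
Lemma ffact_mul_bin n k j : (j <= n)%N ->
  ((n + k) ^_ k * 'C(n, j) = 'C(n + k, j + k) * (j + k) ^_ k)%N.
Proof.
move=> lejn; have fact_n : (0 < j`! * (n - j)`!)%N by rewrite muln_gt0 !fact_gt0.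
apply/eqP; rewrite -(eqn_pmul2r fact_n) -mulnA bin_fact //; apply/eqP.
have ffactE m : ((m + k) ^_ k * m`! = (m + k)`!)%N.
  by rewrite -{2}(addnK k m) ffact_fact // leq_addl.
by rewrite ffactE -mulnA (mulnA (_ ^_ _)) ffactE -(subnDr k) bin_fact // leq_add2r.
Qed.

Lemma universal_factor_S_nk n k R : (size (R - 'X^k)%R <= k - n)%N ->
  universal_factor n k R (S_nk F n k).
Proof.
move=> sR; split=> [|P Q sP [sQ QE]].
  rewrite /has_degree size_poly_eq // !binn ?oner_eq0 //.
have {}QE : ('X^k * Q)^`(k) = rising_fact n.+1%:R k *: P.
  rewrite -QE -[in RHS](subrK 'X^k R) mulrDl linearD /=.
  by rewrite (derivn_mul_low sR) ?add0r // sQ.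
apply/polyP => j; rewrite coef_poly; case: ltnP => [ltjn|lenj]; last first.
  by rewrite nth_default // sQ.
have nzC : 'C(n, j)%:R != 0 :> F by rewrite pnatr_eq0 -lt0n bin_gt0.
have nzk : ((k + j) ^_ k)%:R != 0 :> F.
  by rewrite pnatr_eq0 -lt0n ffact_gt0 leq_addr.
(* The monomial of degree j is an eigenvector of Q |-> (X^k Q)^(k), with eigenvalue
   [(k + j) ^_ k]. *)
have := congr1 (fun p : {poly F} => p`_j) QE.
rewrite coef_derivn coefXnM ltnNge leq_addr addKn coefZ rising_factE /=.
move=> QjE; rewrite /binom_coef coef_poly ltjn [X in X * _]mulrC divfK //.
apply: (mulIf nzk); apply: (mulIf nzC); rewrite [Q`_j * _]mulr_natr QjE mulrAC -natrM.
rewrite ffact_mul_bin // natrM (addnC j k).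
by rewrite [RHS]mulrAC mulrA divfK // mulrC mulrA.
Qed.

Lemma universal_factor_low n k R S : (0 < n)%N -> R \is monic ->
  size R = k.+1 -> universal_factor n k R S -> (size (R - 'X^k)%R <= k - n)%N.
Proof.
move=> n0 Rmon sR [sS univ].
pose L Q := (R * Q)^`(k).
have LD Q Q' : L (Q + Q') = L Q + L Q' by rewrite /L mulrDr linearD.
(* In degree 0 the binomial weights are 1, so the convolution gives Q_0 = P_0 S_0, where P is [L Q]
   divided by the rising factorial. *)
pose s := (rising_fact n.+1%:R k)^-1 * S`_0.
have top Q : size Q = n.+1 -> Q`_0 = (L Q)`_0 * s.
  move=> sQ; pose P := (rising_fact n.+1%:R k)^-1 *: L Q.
  have {1}-> : Q = gs_conv n P S.
    apply: univ.
      rewrite /has_degree size_scale ?invr_eq0 ?rising_fact_neq0 //.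
      by rewrite size_derivn_mul.
    by split; rewrite // scalerA divff ?rising_fact_neq0 // scale1r.
  rewrite coef_poly /= /binom_coef bin0 !divr1 mul1r coefZ.
  by rewrite mulrAC mulrC.
have low Q : (size Q <= n.+1)%N -> Q`_0 = (L Q)`_0 * s.
  rewrite leq_eqVlt => /predU1P[|ltQn]; first exact: top.
  (* Adding 'X^n raises the degree to exactly n; the relation for 'X^n itself is then subtracted. *)
  have sXn : size ('X^n : {poly F}) = n.+1 by rewrite size_polyXn.
  have sQXn : size (Q + 'X^n) = n.+1 by rewrite addrC size_polyDl ?sXn.
  have := top _ sQXn.
  by rewrite LD !coefD mulrDl (top _ sXn) => /addIr.
have s0 : s != 0.
  have := low 1; rewrite size_poly1 coef1 eqxx => /(_ isT) /eqP.
  by apply: contraTneq => ->; rewrite mulr0 oner_eq0.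
apply/leq_sizeP => j lej; rewrite coefB coefXn.
have [ltjk|ltkj|->] := ltngtP j k.
- rewrite subr0; have lekn : (k - j <= n)%N by rewrite leq_subCl.
  (* The constant term of 'X^(k - j) vanishes, while that of its image under [L] is k! times the
     j-th coefficient of [R]. *)
  have := low 'X^(k - j); rewrite size_polyXn ltnS lekn => /(_ isT) /esym.
  rewrite coefXn eq_sym subn_eq0 leqNgt ltjk => /eqP.
  rewrite mulf_eq0 (negPf s0) orbF coef_derivn addn0 coefMXn.
  rewrite ltnNge leq_subr subKn 1?ltnW // mulrn_eq0 -leqn0 leqNgt ffact_gt0.
  by rewrite leqnn => /eqP.
- by rewrite nth_default ?subr0 // sR.
- by have /eqP := monicP Rmon; rewrite lead_coefE sR => /eqP->; rewrite subrr.
Qed.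

Lemma universal_factorP n k R : (0 < n)%N -> R \is monic -> size R = k.+1 ->
  (exists S, universal_factor n k R S) <-> (size (R - 'X^k)%R <= k - n)%N.
Proof.
move=> n0 Rmon sR; split=> [[S] | sRX]; first exact: universal_factor_low.
by exists (S_nk F n k); apply: universal_factor_S_nk.
Qed.

(** For k <= n the truncated [k - n] is 0, so the size bound forces R - X^k = 0. *)
Lemma universal_factor_XnP n k R : (0 < n)%N -> (k <= n)%N ->
  R \is monic -> size R = k.+1 ->
  (exists S, universal_factor n k R S) <-> R = 'X^k.
Proof.
move=> n0 lekn Rmon sR; rewrite universal_factorP //.
rewrite (eqnP lekn) leqn0 size_poly_eq0 subr_eq0.
by split=> [/eqP|->].
Qed.

(** * Coefficients of monic polynomials *)

Lemma size_monic_poly k (r : 'I_k -> F) : size (monic_poly r) = k.+1.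
Proof.
rewrite /monic_poly size_polyDl ?size_polyXn // ltnS.
apply: leq_trans (size_sum _ _ _) _; apply/bigmax_leqP => l _.
by rewrite (leq_trans (size_scale_leq _ _)) // size_polyXn ltn_ord.
Qed.

Lemma coef_monic_poly k (r : 'I_k -> F) j :
  (monic_poly r)`_j = (j == k)%:R + \sum_(l < k | l == j :> nat) r l.
Proof. by rewrite /monic_poly coefD coefXn coef_sumMXn. Qed.

Lemma coef_monic_poly_ord k (r : 'I_k -> F) (l : 'I_k) :
  (monic_poly r)`_l = r l.
Proof.
by rewrite coef_monic_poly ltn_eqF ?ltn_ord // add0r (big_pred1 l).
Qed.

Lemma monic_poly_monic k (r : 'I_k -> F) : monic_poly r \is monic.
Proof.
apply/monicP; rewrite lead_coefE size_monic_poly coef_monic_poly eqxx big1 ?addr0 //.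
by move=> l /eqP lk; have := ltn_ord l; rewrite lk ltnn.
Qed.

(** A general monic [P] serves two uses: X^k for the vanishing condition, and a second [monic_poly]
    for the invisible coefficients. *)
Lemma size_monic_poly_subP k m (r : 'I_k -> F) P :
  P \is monic -> size P = k.+1 ->
  (size (monic_poly r - P)%R <= m)%N <->
  (forall l : 'I_k, (m <= l)%N -> r l = P`_l).
Proof.
move=> Pmon sP; split=> [/leq_sizeP sr l lem | rP].
  by apply/eqP; rewrite -subr_eq0 -(coef_monic_poly_ord r) -coefB sr.
apply/leq_sizeP => j lemj; rewrite coefB; apply/eqP; rewrite subr_eq0; apply/eqP.
have [ltjk|ltkj|->] := ltngtP j k.
- by rewrite (coef_monic_poly_ord r (Ordinal ltjk)) rP.
- by rewrite !nth_default ?size_monic_poly ?sP.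
have lead Q : Q \is monic -> size Q = k.+1 -> Q`_k = 1.
  by move=> /monicP; rewrite lead_coefE => + sQ; rewrite sQ.
by rewrite !lead ?size_monic_poly ?monic_poly_monic.
Qed.

(** * Translation of the variable *)

Lemma translateK xi : cancel (translate xi) (translate (- xi)).
Proof. by move=> P; rewrite /translate polyCN comp_polyXaddC_K. Qed.

Lemma translateNK xi : cancel (translate (- xi)) (translate xi).
Proof. by move=> P; rewrite -{1}[xi]opprK translateK. Qed.

Lemma size_translate xi P : size (translate xi P) = size P.
Proof. by rewrite size_comp_poly2 // size_XaddC. Qed.

Lemma translate_monic xi P : P \is monic -> translate xi P \is monic.
Proof.
move=> /monicP Pmon; apply/monicP.
by rewrite lead_coef_comp ?size_XaddC // lead_coefXaddC expr1n mulr1.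
Qed.

Lemma derivn_translate xi k P : (translate xi P)^`(k) = translate xi P^`(k).
Proof.
elim: k => // k IHk.
by rewrite !derivnS IHk deriv_comp derivD derivX derivC addr0 mulr1.
Qed.

Lemma is_solution_translate xi n k R P Q :
  is_solution n k R P Q ->
  is_solution n k (translate xi R) (translate xi P) (translate xi Q).
Proof.
case=> sQ QE; split; first by rewrite /has_degree size_translate.
by rewrite -comp_polyM derivn_translate QE /translate comp_polyZ.
Qed.

(** Translation is a degree-preserving bijection carrying solutions for [R] to solutions for
    [translate xi R]. *)
Lemma universal_factor_atE xi n k R S :
  universal_factor_at xi n k R S <-> universal_factor n k (translate xi R) S.
Proof.
split=> -[sS univ]; split=> // P Q sP sol.
  rewrite -(translateNK xi P) -(translateNK xi Q); apply: univ.
    by rewrite /has_degree size_translate.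
  by rewrite -(translateK xi R); apply: is_solution_translate.
apply: univ; first by rewrite /has_degree size_translate.
exact: is_solution_translate.
Qed.

Lemma translate_eqXn xi k R : translate xi R = 'X^k <-> R = ('X - xi%:P) ^+ k.
Proof.
have XnE : translate (- xi) 'X^k = ('X - xi%:P) ^+ k.
  by rewrite /translate comp_Xn_poly polyCN.
rewrite -XnE; split=> [<-|->]; first by rewrite translateK.
by rewrite translateNK.
Qed.

End Solutions.

Theorem proposition4p1 (T : realType) (n k : nat)
    (hn : (1 <= n)%N) (hk : (1 <= k)%N) :
  (forall r : 'I_k -> T[i],
    let R := monic_poly r in
    let star := forall l : 'I_k, (maxn 0 (k - n) <= l)%N -> r l = 0 in
    [/\ forall P : {poly T[i]}, has_degree n P ->
          exists! Q : {poly T[i]}, is_solution n k R P Q,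
        (exists S : {poly T[i]}, universal_factor n k R S) <-> star,
        star -> universal_factor n k R (S_nk T[i] n k),
        forall r' : 'I_k -> T[i],
          (forall l : 'I_k, ~~ (l + n < k)%N -> r' l = r l) ->
          forall Q : {poly T[i]}, (size Q <= n.+1)%N ->
            (monic_poly r' * Q)^`(k) = (R * Q)^`(k)
      & (k <= n)%N ->
          ((exists S : {poly T[i]}, universal_factor n k R S) <-> R = 'X^k)])
  /\
  ((k <= n)%N ->
    forall (xi : T[i]) (R : {poly T[i]}), R \is monic -> has_degree k R ->
      ((exists S : {poly T[i]}, universal_factor_at xi n k R S) <->
       R = ('X - xi%:P) ^+ k)).
Proof.
split=> [r R star | lekn xi R Rmon sR]; last first.
  rewrite -translate_eqXn -(universal_factor_XnP hn lekn);
    rewrite ?translate_monic ?size_translate //.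
  by split=> -[S /universal_factor_atE univ]; exists S.
have Rmon : R \is monic := monic_poly_monic r.
have sR : size R = k.+1 := size_monic_poly r.
have starP : (size (R - 'X^k)%R <= k - n)%N <-> star.
  rewrite size_monic_poly_subP ?monicXn ?size_polyXn // /star max0n.
  by split=> rP l /rP->; rewrite coefXn ltn_eqF.
split.
- by move=> P; apply: is_solution_unique.
- by rewrite -starP; apply: universal_factorP.
- by rewrite -starP; apply: universal_factor_S_nk.
(* The two monic polynomials agree in all degrees from [k - n] on, so their difference times [Q] has
   degree below k. *)
- move=> r' r'E Q sQ; apply/eqP; rewrite -subr_eq0 -linearB /= -mulrBl.
  rewrite (@derivn_mul_low _ n) //; apply/size_monic_poly_subP => // l.
  by rewrite leq_subLR addnC => lel; rewrite coef_monic_poly_ord r'E // -leqNgt.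
- by move=> lekn; apply: universal_factor_XnP.
Qed.
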